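(* Suppose that $f(z)=\sum_{k=0}^\infty a_k z^k$ is analytic in $\mathbb{D}$ and $|f(z)|\le 1$ in $\mathbb{D}$. Then, with $|z|=r$, $$|f(z)|^2+\sum_{k=1}^\infty |a_k|^2r^{2k}\le 1\quad\text{for } r\le\sqrt{\frac{11}{27}},$$ and this number cannot be improved ($\sqrt{11/27}$ cannot be replaced by any larger number such that the inequality still holds for all such $f$).
   Context: $\mathbb{D}=\{z\in\mathbb{C}:|z|<1\}$ is the open unit disk. Throughout, $r=|z|$ with $z\in\mathbb{D}$, and the inequality is asserted for every $z$ with $|z|=r$ in the indicated range. *)

(* Defs.v *)
(* Stdlib reals with Coquelicot. *)
From Stdlib Require Import Reals.
From Coquelicot Require Import Coquelicot.
Open Scope R_scope.

(* Since [ex_derive] is taken over the absolute ring C, this is complex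
   differentiability. *)
Definition analytic_on_disk (f : C -> C) : Prop :=
  forall z : C, Cmod z < 1 -> ex_derive (K := C_AbsRing) (V := C_NormedModule) f z.

(* f(z) = \sum_(k >= 0) a_k z^k is analytic in the open unit disk and bounded
   there by 1; nothing is required of f outside the disk. *)
Definition bounded_analytic (a : nat -> C) (f : C -> C) : Prop :=
  analytic_on_disk f /\
  (forall z : C, Cmod z < 1 ->
     is_pseries (K := C_AbsRing) (V := C_NormedModule) a z (f z)) /\
  (forall z : C, Cmod z < 1 -> Cmod (f z) <= 1).

(* |a_k|^2 r^(2k) for k = n + 1: [Series] starts at n = 0, the sum at k = 1. *)
Definition sq_term (a : nat -> C) (r : R) (n : nat) : R :=
  Cmod (a (S n)) ^ 2 * r ^ (2 * S n).

(* Main.v *)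
Require Import Defs.
From Stdlib Require Import Reals.
From Coquelicot Require Import Coquelicot.
From Stdlib Require Import Lra Lia.
Open Scope R_scope.

(** Write [a = |a_0|], [r = |z|] and [S] for the sum over [k >= 1]. Everything follows
    from the Schwarz-Pick inequality
    [|f(z) - a_0| <= |z| |1 - Cconj a_0 f(z)|] ([schwarz_pick]).

    Read pointwise, it gives [|f(z)| <= (a + r) / (1 + a r)] ([schwarz_pick_growth]).
    Squared and averaged over the circle of radius [r], it gives by Parseval's identity
    [S (1 - a^2 r^2) <= r^2 (1 - a^2)^2] ([coef_norm_schwarz_pick]). After these two bounds
    are inserted and a factor [1 - a^2] is cancelled, the claim reads
    [2 r^2 - 1 + y - y^2 - y^3 <= 0] with [y = a r]; the cubic is largest at [y = 1/3], and
    there the condition is [r^2 <= 11/27] ([bohr_arithmetic]). Both bounds are equalities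
    for the Mobius map [(a + z) / (1 + a z)] at [z = r], and [a = 1 / (3 r)] makes the
    cubic maximal, so no larger radius is possible ([mobius_exceeds_1]).

    The Schwarz-Pick inequality itself is derived from means over circles, as is
    Parseval's identity, so that no contour integral and no maximum principle is used. A
    mean is a limit of averages over roots of unity ([has_mean]); it is linear and
    positive, and absolutely convergent power series can be averaged term by term
    ([has_mean_mul_expands]). Schwarz-Pick is then the positivity of the 2 by 2 Pick
    matrix at the points 0 and [z], which expresses that the adjoint of multiplication
    by [f] is a contraction on the span of two reproducing kernels
    ([schwarz_pick_circle]). *)

(** * Limits and series of complex numbers *)

Notation Clim u l := (filterlim (u : nat -> C) eventually (locally (l : C))).
Notation Cseries := (is_series (K := C_AbsRing) (V := C_NormedModule)).

(** [sum_n] and [is_series] type complex numbers by the carrier of an algebraic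
    structure; [ring] needs the carrier to be literally [C]. *)
Ltac Cring := match goal with |- @eq _ ?a ?b => change (@eq C a b); ring end.

Lemma Clim_eps (u : nat -> C) (l : C) :
  Clim u l <->
  forall eps, 0 < eps -> exists N, forall n, (N <= n)%nat -> Cmod (u n - l) < eps.
Proof.
  rewrite (filterlim_locally_ball_norm (K := C_AbsRing) (U := C_NormedModule)).
  split.
  - intros H eps Heps. exact (H (mkposreal eps Heps)).
  - intros H eps. exact (H eps (cond_pos eps)).
Qed.

Lemma Clim_plus (u v : nat -> C) (l m : C) :
  Clim u l -> Clim v m -> Clim (fun n => u n + v n)%C (l + m)%C.
Proof.
  intros Hu Hv.
  exact (filterlim_comp_2 _ _ _ Hu Hv
           (filterlim_plus (K := C_AbsRing) (V := C_NormedModule) l m)).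
Qed.

Lemma Clim_scal (x : C) (u : nat -> C) (l : C) :
  Clim u l -> Clim (fun n => x * u n)%C (x * l)%C.
Proof.
  intros Hu.
  exact (filterlim_comp _ _ _ _ _ _ _ _ Hu
           (filterlim_scal_r (K := C_AbsRing) (V := C_NormedModule) x l)).
Qed.

Lemma Cconj_RtoC (x : R) : Cconj (RtoC x) = RtoC x.
Proof. unfold Cconj, RtoC; simpl. f_equal. ring. Qed.

Lemma Clim_conj (u : nat -> C) (l : C) :
  Clim u l -> Clim (fun n => Cconj (u n)) (Cconj l).
Proof.
  rewrite !Clim_eps. intros H eps Heps. destruct (H eps Heps) as [N HN].
  exists N. intros n Hn. rewrite <- Cminus_conj, Cmod_conj. now apply HN.
Qed.

Lemma Clim_Re_ge0 (u : nat -> C) (l : C) :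
  (forall n, 0 <= Re (u n)) -> Clim u l -> 0 <= Re l.
Proof.
  rewrite Clim_eps. intros Hu Hl.
  destruct (Rle_lt_dec 0 (Re l)) as [H | H]; [exact H | exfalso].
  destruct (Hl (- Re l)) as [N HN]; [lra |].
  specialize (HN N (Nat.le_refl N)). specialize (Hu N).
  pose proof (re_le_Cmod (u N - l)) as Hre.
  unfold Cminus in Hre. rewrite re_plus, re_opp in Hre.
  pose proof (Rle_abs (Re (u N) + - Re l)). unfold Cminus in HN. lra.
Qed.

(** Fixing the carrier to [C] keeps the ring tactics usable on partial sums. *)
Definition Csum (u : nat -> C) (n : nat) : C := sum_n (G := C_AbelianGroup) u n.

Lemma Cseries_eps (u : nat -> C) (l : C) :
  Cseries u l <->
  forall eps, 0 < eps -> exists N, forall n, (N <= n)%nat -> Cmod (Csum u n - l) < eps.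
Proof. exact (Clim_eps (Csum u) l). Qed.

Lemma Csum_ext (u v : nat -> C) (n : nat) :
  (forall k, u k = v k) -> Csum u n = Csum v n.
Proof. apply sum_n_ext. Qed.

Lemma Csum_S (u : nat -> C) (n : nat) : Csum u (S n) = (Csum u n + u (S n))%C.
Proof. exact (sum_Sn u n). Qed.

Lemma Csum_0 (u : nat -> C) : Csum u 0%nat = u 0%nat.
Proof. exact (sum_O u). Qed.

Lemma Csum_plus (u v : nat -> C) (n : nat) :
  Csum (fun k => u k + v k)%C n = (Csum u n + Csum v n)%C.
Proof. exact (sum_n_plus u v n). Qed.

Lemma Csum_scal (x : C) (u : nat -> C) (n : nat) :
  Csum (fun k => x * u k)%C n = (x * Csum u n)%C.
Proof. exact (sum_n_mult_l (K := C_Ring) x u n). Qed.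

Lemma Csum_conj (u : nat -> C) (n : nat) :
  Csum (fun k => Cconj (u k)) n = Cconj (Csum u n).
Proof.
  induction n as [|n IH].
  - now rewrite !Csum_0.
  - now rewrite !Csum_S, IH, Cplus_conj.
Qed.

Lemma Csum_Cmod_le (u : nat -> C) (B : R) (n : nat) :
  (forall k, Cmod (u k) <= B) -> Cmod (Csum u n) <= INR (S n) * B.
Proof.
  intros H. induction n as [|n IH].
  - rewrite Csum_0. simpl. specialize (H 0%nat). lra.
  - rewrite Csum_S, S_INR. eapply Rle_trans; [apply Cmod_triangle |].
    specialize (H (S n)). lra.
Qed.

Lemma Csum_RtoC (u : nat -> R) (n : nat) :
  Csum (fun k => RtoC (u k)) n = RtoC (sum_n u n).
Proof.
  induction n as [|n IH].
  - now rewrite Csum_0, sum_O.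
  - rewrite Csum_S, IH, sum_Sn. unfold plus; simpl. now rewrite RtoC_plus.
Qed.

Lemma Cseries_RtoC (u : nat -> R) (l : R) :
  is_series u l -> Cseries (fun k => RtoC (u k)) (RtoC l).
Proof.
  intros H.
  assert (H' : is_lim_seq (sum_n u) l) by exact H.
  apply is_lim_seq_spec in H'.
  apply Cseries_eps. intros eps Heps.
  destruct (H' (mkposreal eps Heps)) as [N HN]. exists N. intros n Hn.
  rewrite Csum_RtoC, <- RtoC_minus, Cmod_R. now apply HN.
Qed.

Lemma Cseries_single (j : nat) (x : C) :
  Cseries (fun k => if Nat.eqb k j then x else RtoC 0) x.
Proof.
  apply Cseries_eps. intros eps Heps. exists j. intros n Hn.
  replace (Csum _ n) with x.
  - replace (x - x)%C with (RtoC 0) by Cring. now rewrite Cmod_0.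
  - assert (Hs : forall m, Csum (fun k => if Nat.eqb k j then x else RtoC 0) m
                           = if Nat.leb j m then x else RtoC 0).
    { induction m as [|m IH].
      - rewrite Csum_0. destruct j; reflexivity.
      - rewrite Csum_S, IH.
        destruct (Nat.leb_spec j m); destruct (Nat.leb_spec j (S m));
          destruct (Nat.eqb_spec (S m) j); try lia; Cring. }
    rewrite Hs. destruct (Nat.leb_spec j n); [reflexivity | lia].
Qed.

Lemma Cseries_geom (x : C) : Cmod x < 1 -> Cseries (fun k => x ^ k)%C (/ (1 - x))%C.
Proof.
  intros Hx.
  assert (H1 : (1 - x)%C <> 0).
  { intros H. assert (E : x = 1) by (replace x with (1 - (1 - x))%C by ring; rewrite H; ring).
    rewrite E, Cmod_1 in Hx. lra. }
  assert (Hs : forall n, (Csum (fun k => x ^ k) n - / (1 - x) = - / (1 - x) * x ^ S n)%C).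
  { induction n as [|n IH].
    - rewrite Csum_0. simpl. field. exact H1.
    - rewrite Csum_S.
      replace (Csum _ n) with ((Csum (fun k => x ^ k) n - / (1 - x)) + / (1 - x))%C by ring.
      rewrite IH. rewrite (Cpow_S x (S n)). field. exact H1. }
  pose proof (is_lim_seq_geom (Cmod x)) as Hg.
  rewrite Rabs_pos_eq in Hg by apply Cmod_ge_0. specialize (Hg Hx).
  apply is_lim_seq_spec in Hg.
  apply Cseries_eps. intros eps Heps.
  set (M := Cmod (- / (1 - x))).
  assert (HM : 0 <= M) by apply Cmod_ge_0.
  assert (He : 0 < eps / (M + 1)) by (apply Rdiv_lt_0_compat; lra).
  destruct (Hg (mkposreal _ He)) as [N HN]. exists N. intros n Hn.
  rewrite Hs, Cmod_mult, Cmod_pow. fold M.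
  assert (Hn' : (N <= S n)%nat) by lia.
  specialize (HN (S n) Hn'). cbn [pos] in HN. rewrite Rminus_0_r in HN.
  pose proof (Rle_abs (Cmod x ^ S n)).
  assert (0 <= Cmod x ^ S n) by (apply pow_le, Cmod_ge_0).
  apply Rle_lt_trans with ((M + 1) * Cmod x ^ S n); [nra |].
  replace eps with ((M + 1) * (eps / (M + 1))) by (field; lra).
  apply Rmult_lt_compat_l; lra.
Qed.

(** A quantitative form of: the radius of convergence exceeds 1. It makes the series
    converge uniformly on the unit circle, which is what lets a mean value be taken
    term by term. *)
Definition geometric (c : nat -> C) : Prop :=
  exists A rho, 0 <= A /\ 0 <= rho < 1 /\ forall k, Cmod (c k) <= A * rho ^ k.

(** The tail of the majorizing geometric series bounds every difference of two
    partial sums beyond [K], hence the difference with the limit. The bound depends on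
    [A] and [rho] only, so it is uniform over any family with this majorant. *)
Lemma Cseries_tail (u : nat -> C) (l : C) (A rho : R) (K : nat) :
  0 <= A -> 0 <= rho < 1 -> (forall k, Cmod (u k) <= A * rho ^ k) -> Cseries u l ->
  Cmod (l - Csum u K) <= A * rho ^ S K / (1 - rho).
Proof.
  intros HA Hr Hu Hl.
  assert (H : forall n, Cmod (Csum u (K + n) - Csum u K)
                        <= A * (rho ^ S K - rho ^ S (K + n)) / (1 - rho)).
  { induction n as [|n IH].
    - rewrite Nat.add_0_r. replace (_ - _)%C with (RtoC 0) by ring. rewrite Cmod_0.
      right. field. lra.
    - rewrite Nat.add_succ_r, Csum_S.
      replace (_ - _)%C with ((Csum u (K + n) - Csum u K) + u (S (K + n)))%C by ring.
      eapply Rle_trans; [apply Cmod_triangle |].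
      eapply Rle_trans; [apply Rplus_le_compat; [exact IH | apply Hu] |].
      right. simpl. field. lra. }
  destruct (Rle_lt_dec (Cmod (l - Csum u K)) (A * rho ^ S K / (1 - rho))) as [|Hlt];
    [assumption | exfalso].
  rewrite Cseries_eps in Hl.
  destruct (Hl (Cmod (l - Csum u K) - A * rho ^ S K / (1 - rho))) as [N HN]; [lra |].
  specialize (HN (K + N)%nat ltac:(lia)). specialize (H N).
  pose proof (Cmod_triangle (l - Csum u (K + N)) (Csum u (K + N) - Csum u K)) as Ht.
  replace (l - Csum u (K + N) + (Csum u (K + N) - Csum u K))%C
    with (l - Csum u K)%C in Ht by ring.
  rewrite <- (Cmod_opp (l - Csum u (K + N))) in Ht.
  replace (- (l - Csum u (K + N)))%C with (Csum u (K + N) - l)%C in Ht by ring.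
  assert (A * (rho ^ S K - rho ^ S (K + N)) / (1 - rho) <= A * rho ^ S K / (1 - rho)).
  { apply Rmult_le_compat_r; [left; apply Rinv_0_lt_compat; lra |].
    apply Rmult_le_compat_l; [lra |].
    assert (0 <= rho ^ S (K + N)) by (apply pow_le; lra). lra. }
  lra.
Qed.

(** * Averages over roots of unity *)

Definition cis (t : R) : C := (cos t, sin t).

Lemma Cmod_cis (t : R) : Cmod (cis t) = 1.
Proof.
  unfold Cmod, cis; simpl. rewrite !Rmult_1_r.
  replace (_ + _) with 1; [apply sqrt_1 |].
  pose proof (sin2_cos2 t). unfold Rsqr in H. lra.
Qed.

Lemma cis_plus (s t : R) : cis (s + t) = (cis s * cis t)%C.
Proof. unfold cis, Cmult; simpl. rewrite cos_plus, sin_plus. f_equal; ring. Qed.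

Lemma cis_pow (t : R) (k : nat) : (cis t ^ k)%C = cis (INR k * t).
Proof.
  induction k as [|k IH].
  - simpl. rewrite Rmult_0_l. unfold cis. now rewrite cos_0, sin_0.
  - rewrite Cpow_S, IH, S_INR, <- cis_plus. f_equal. ring.
Qed.

Lemma cis_period (k : nat) : cis (INR k * (2 * PI)) = 1.
Proof.
  rewrite <- cis_pow. unfold cis. rewrite cos_2PI, sin_2PI. apply Cpow_1_l.
Qed.

Lemma cis_neq_1 (t : R) : 0 < t < 2 * PI -> cis t <> 1.
Proof.
  intros Ht H. unfold cis in H. injection H as Hc _.
  replace t with (2 * (t / 2)) in Hc by field.
  rewrite cos_2a_sin in Hc.
  pose proof (sin_gt_0 (t / 2) ltac:(lra) ltac:(lra)). nra.
Qed.

(** Level [n] uses the roots of order [n + 1], so that there is no empty average. *)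
Definition root_of_unity (n j : nat) : C := cis (INR j * (2 * PI / INR (S n))).

Definition avg (n : nat) (g : C -> C) : C :=
  (/ INR (S n) * Csum (fun j => g (root_of_unity n j)) n)%C.

Lemma INR_S_neq0 n : INR (S n) <> 0.
Proof. apply not_0_INR. lia. Qed.

Lemma Cmod_root n j : Cmod (root_of_unity n j) = 1.
Proof. apply Cmod_cis. Qed.

Lemma avg_ext (n : nat) (g h : C -> C) :
  (forall x, Cmod x = 1 -> g x = h x) -> avg n g = avg n h.
Proof.
  intros H. unfold avg. f_equal. apply Csum_ext. intros j. apply H, Cmod_root.
Qed.

Lemma avg_plus n g h : avg n (fun x => g x + h x)%C = (avg n g + avg n h)%C.
Proof. unfold avg. rewrite Csum_plus. ring. Qed.

Lemma avg_scal n (c : C) g : avg n (fun x => c * g x)%C = (c * avg n g)%C.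
Proof. unfold avg. rewrite Csum_scal. ring. Qed.

Lemma avg_conj n g : avg n (fun x => Cconj (g x)) = Cconj (avg n g).
Proof.
  unfold avg. rewrite Csum_conj, Cmult_conj. f_equal.
  rewrite <- RtoC_inv by apply INR_S_neq0.
  symmetry. apply Cconj_RtoC.
Qed.

Lemma avg_Cmod_le n g B :
  (forall x, Cmod x = 1 -> Cmod (g x) <= B) -> Cmod (avg n g) <= B.
Proof.
  intros H. unfold avg. rewrite Cmod_mult, <- RtoC_inv by apply INR_S_neq0.
  pose proof (lt_0_INR (S n) ltac:(lia)) as Hn.
  rewrite Cmod_R, Rabs_pos_eq by (left; now apply Rinv_0_lt_compat).
  replace B with (/ INR (S n) * (INR (S n) * B)) by (field; lra).
  apply Rmult_le_compat_l; [left; now apply Rinv_0_lt_compat |].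
  apply Csum_Cmod_le. intros j. apply H, Cmod_root.
Qed.

Lemma avg_Re_ge0 n g : (forall x, Cmod x = 1 -> 0 <= Re (g x)) -> 0 <= Re (avg n g).
Proof.
  intros H. unfold avg. rewrite <- RtoC_inv by apply INR_S_neq0. rewrite re_scal_l.
  apply Rmult_le_pos; [left; apply Rinv_0_lt_compat, lt_0_INR; lia |].
  assert (Hs : forall m, 0 <= Re (Csum (fun j => g (root_of_unity n j)) m)).
  { induction m as [|m IH].
    - rewrite Csum_0. apply H, Cmod_root.
    - rewrite Csum_S, re_plus. specialize (H _ (Cmod_root n (S m))). lra. }
  apply Hs.
Qed.

(** For [0 < d <= n] the [d]-th powers of the roots are the successive powers of one
    number [w <> 1] with [w ^ (n + 1) = 1], and their geometric sum vanishes. For a fixed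
    exponent the average is therefore exact once [n] is large. *)
Lemma avg_pow (n d : nat) :
  (d <= n)%nat -> avg n (fun x => x ^ d)%C = if Nat.eqb d 0 then 1 else 0.
Proof.
  intros Hd.
  pose proof (lt_0_INR (S n) ltac:(lia)) as Hn.
  assert (HnC : RtoC (INR (S n)) <> 0) by (intros H; apply RtoC_inj in H; lra).
  set (t := INR d * (2 * PI / INR (S n))).
  assert (E : forall j, (root_of_unity n j ^ d)%C = (cis t ^ j)%C).
  { intros j. unfold root_of_unity. rewrite !cis_pow. f_equal. unfold t. ring. }
  unfold avg. rewrite (Csum_ext _ _ n E).
  destruct (Nat.eqb_spec d 0) as [-> | Hd0].
  - assert (H : forall m, Csum (fun j => cis t ^ j)%C m = RtoC (INR (S m))).
    { assert (Ht : cis t = 1).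
      { unfold t. simpl. rewrite Rmult_0_l. unfold cis. now rewrite cos_0, sin_0. }
      rewrite Ht. induction m as [|m IH].
      - rewrite Csum_0. reflexivity.
      - rewrite Csum_S, IH, Cpow_1_l, (S_INR (S m)), RtoC_plus. reflexivity. }
    rewrite H. field. exact HnC.
  - assert (H : forall m, ((cis t - 1) * Csum (fun j => cis t ^ j) m = cis t ^ S m - 1)%C).
    { induction m as [|m IH].
      - rewrite Csum_0. simpl. ring.
      - rewrite Csum_S, Cmult_plus_distr_l, IH, (Cpow_S _ (S m)). ring. }
    specialize (H n). rewrite (cis_pow t (S n)) in H.
    replace (INR (S n) * t) with (INR d * (2 * PI)) in H by (unfold t; field; lra).
    rewrite cis_period in H.
    assert (Hne : (cis t - 1)%C <> 0).
    { intros H0. apply (cis_neq_1 t).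
      - pose proof PI_RGT_0. pose proof (lt_0_INR d ltac:(lia)).
        assert (INR d < INR (S n)) by (apply lt_INR; lia).
        assert (0 < 2 * PI / INR (S n)) by (apply Rdiv_lt_0_compat; lra).
        unfold t. split; [nra |].
        replace (2 * PI) with (INR (S n) * (2 * PI / INR (S n))) at 2 by (field; lra).
        apply Rmult_lt_compat_r; lra.
      - replace (cis t) with ((cis t - 1) + 1)%C by ring. rewrite H0. ring. }
    set (T := Csum _ n) in *.
    assert (HT : T = RtoC 0).
    { transitivity (/ (cis t - 1) * ((cis t - 1) * T))%C; [field; exact Hne |].
      rewrite H. ring. }
    rewrite HT. ring.
Qed.

(** * Mean values on the unit circle *)

(** The limit of these averages stands for the integral over the circle with respect
    to normalized arc length; only its linearity, its positivity, the bound by the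
    supremum and the values on monomials matter below. *)
Definition has_mean (g : C -> C) (l : C) : Prop := Clim (fun n => avg n g) l.

Lemma has_mean_ext (g h : C -> C) (l : C) :
  (forall x, Cmod x = 1 -> g x = h x) -> has_mean g l -> has_mean h l.
Proof.
  intros H. unfold has_mean. apply filterlim_ext. intros n. now apply avg_ext.
Qed.

Lemma has_mean_plus g h l m :
  has_mean g l -> has_mean h m -> has_mean (fun x => g x + h x)%C (l + m)%C.
Proof.
  intros Hg Hh. unfold has_mean. eapply filterlim_ext.
  - intros n. symmetry. apply avg_plus.
  - now apply Clim_plus.
Qed.

Lemma has_mean_scal c g l : has_mean g l -> has_mean (fun x => c * g x)%C (c * l)%C.
Proof.
  intros Hg. unfold has_mean. eapply filterlim_ext.
  - intros n. symmetry. apply avg_scal.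
  - now apply Clim_scal.
Qed.

Lemma has_mean_conj g l : has_mean g l -> has_mean (fun x => Cconj (g x)) (Cconj l).
Proof.
  intros Hg. unfold has_mean. eapply filterlim_ext.
  - intros n. symmetry. apply avg_conj.
  - now apply Clim_conj.
Qed.

Lemma has_mean_Re_ge0 g l :
  (forall x, Cmod x = 1 -> 0 <= Re (g x)) -> has_mean g l -> 0 <= Re l.
Proof.
  intros H. apply Clim_Re_ge0. intros n. now apply avg_Re_ge0.
Qed.

Lemma has_mean_pow d : has_mean (fun x => x ^ d)%C (if Nat.eqb d 0 then 1 else 0).
Proof.
  apply Clim_eps. intros eps Heps. exists d. intros n Hn. rewrite avg_pow by exact Hn.
  match goal with |- Cmod ?z < _ => replace z with (RtoC 0) by Cring end.
  now rewrite Cmod_0.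
Qed.

Lemma has_mean_const c : has_mean (fun _ => c) c.
Proof.
  apply has_mean_ext with (fun x => c * x ^ 0)%C.
  - intros x _. simpl. ring.
  - pose proof (has_mean_scal c _ _ (has_mean_pow 0)) as H. cbn [Nat.eqb] in H.
    now rewrite Cmult_1_r in H.
Qed.

Lemma conj_unit (x : C) : Cmod x = 1 -> (Cconj x * x = 1)%C.
Proof.
  intros H. rewrite Cmult_comm, <- Cmod2_conj, H. f_equal. ring.
Qed.

(** The powers form an orthonormal system: on the circle [Cconj x = / x], so the
    product is a power of [x] or the conjugate of one. *)
Lemma has_mean_conj_pow_pow j k :
  has_mean (fun x => Cconj x ^ j * x ^ k)%C (if Nat.eqb k j then 1 else 0).
Proof.
  assert (Hc : forall x i, Cmod x = 1 -> (Cconj x ^ i * x ^ i)%C = 1).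
  { intros x i Hx. rewrite <- Cpow_mult_l, (conj_unit x Hx). apply Cpow_1_l. }
  destruct (Nat.le_gt_cases j k) as [Hjk | Hjk].
  - apply has_mean_ext with (fun x => x ^ (k - j))%C.
    + intros x Hx. replace k with (j + (k - j))%nat at 2 by lia.
      rewrite Cpow_add_r, Cmult_assoc, (Hc x j Hx). ring.
    + replace (Nat.eqb k j) with (Nat.eqb (k - j) 0); [apply has_mean_pow |].
      destruct (Nat.eqb_spec (k - j) 0), (Nat.eqb_spec k j); lia.
  - apply has_mean_ext with (fun x => Cconj (x ^ (j - k)))%C.
    + intros x Hx. rewrite Cpow_conj. replace j with ((j - k) + k)%nat at 2 by lia.
      rewrite Cpow_add_r, <- Cmult_assoc, (Hc x k Hx). ring.
    + replace (Nat.eqb k j) with (Nat.eqb (j - k) 0).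
      * replace (if Nat.eqb (j - k) 0 then RtoC 1 else RtoC 0)
          with (Cconj (if Nat.eqb (j - k) 0 then 1 else 0)).
        -- apply has_mean_conj, has_mean_pow.
        -- destruct (Nat.eqb (j - k) 0); apply Cconj_RtoC.
      * destruct (Nat.eqb_spec (j - k) 0), (Nat.eqb_spec k j); lia.
Qed.

Definition expands (c : nat -> C) (F : C -> C) : Prop :=
  geometric c /\ forall x, Cmod x = 1 -> Cseries (fun k => c k * x ^ k)%C (F x).

Lemma expands_tail c F :
  expands c F ->
  exists A rho, 0 <= A /\ 0 <= rho < 1 /\
  forall x K, Cmod x = 1 -> Cmod (F x - Csum (fun k => c k * x ^ k)%C K) <= A * rho ^ K.
Proof.
  intros [(A & rho & HA & Hr & Hc) HF].
  exists (A * rho / (1 - rho)), rho. repeat split; try lra.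
  - apply Rmult_le_pos; [nra | left; apply Rinv_0_lt_compat; lra].
  - intros x K Hx.
    replace (A * rho / (1 - rho) * rho ^ K) with (A * rho ^ S K / (1 - rho))
      by (simpl; field; lra).
    apply Cseries_tail; try assumption.
    + intros k. rewrite Cmod_mult, Cmod_pow, Hx, pow1, Rmult_1_r. apply Hc.
    + now apply HF.
Qed.

Lemma expands_bounded c F :
  expands c F -> exists B, 0 <= B /\ forall x, Cmod x = 1 -> Cmod (F x) <= B.
Proof.
  intros HF. destruct (expands_tail c F HF) as (A & rho & HA & Hr & H).
  exists (A + Cmod (c 0%nat)). split.
  - pose proof (Cmod_ge_0 (c 0%nat)). lra.
  - intros x Hx. specialize (H x 0%nat Hx). rewrite Csum_0 in H. simpl in H.
    replace (F x) with ((F x - c 0%nat * 1) + c 0%nat)%C by ring.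
    eapply Rle_trans; [apply Cmod_triangle |]. lra.
Qed.

(** Integration term by term: multiplying by a bounded function keeps the convergence
    of the series uniform, so the moments of [G] determine the mean of [G * F]. *)
Lemma has_mean_mul_expands (G F : C -> C) (B : R) (c m : nat -> C) (l : C) :
  0 <= B -> (forall x, Cmod x = 1 -> Cmod (G x) <= B) ->
  expands c F ->
  (forall k, has_mean (fun x => G x * x ^ k)%C (m k)) ->
  Cseries (fun k => c k * m k)%C l ->
  has_mean (fun x => G x * F x)%C l.
Proof.
  intros HB HG HF Hm Hl.
  destruct (expands_tail c F HF) as (A & rho & HA & Hr & Htail).
  assert (Hpart : forall K, has_mean (fun x => G x * Csum (fun k => c k * x ^ k) K)%C
                                     (Csum (fun k => c k * m k)%C K)).
  { induction K as [|K IH].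
    - rewrite Csum_0. eapply has_mean_ext; [| exact (has_mean_scal (c 0%nat) _ _ (Hm 0%nat))].
      intros x _. cbv beta. rewrite Csum_0. ring.
    - rewrite Csum_S.
      eapply has_mean_ext;
        [| exact (has_mean_plus _ _ _ _ IH (has_mean_scal (c (S K)) _ _ (Hm (S K))))].
      intros x _. cbv beta. rewrite Csum_S. ring. }
  apply Clim_eps. intros eps Heps.
  (* One third of [eps] each for the tail of [F], for averaging the partial sum, and
     for the tail of the series of moments. *)
  rewrite Cseries_eps in Hl.
  destruct (Hl (eps / 3) ltac:(lra)) as [K1 HK1].
  pose proof (is_lim_seq_geom rho) as Hg. rewrite Rabs_pos_eq in Hg by lra.
  specialize (Hg (proj2 Hr)). apply is_lim_seq_spec in Hg.
  assert (HBA : 0 <= B * A) by nra.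
  assert (He : 0 < eps / 3 / (B * A + 1)) by (apply Rdiv_lt_0_compat; lra).
  destruct (Hg (mkposreal _ He)) as [K2 HK2].
  set (K := Nat.max K1 K2).
  specialize (HK1 K ltac:(lia)). specialize (HK2 K ltac:(lia)).
  cbn [pos] in HK2. rewrite Rminus_0_r, Rabs_pos_eq in HK2 by (apply pow_le; lra).
  specialize (Hpart K). unfold has_mean in Hpart. rewrite Clim_eps in Hpart.
  destruct (Hpart (eps / 3) ltac:(lra)) as [N HN]. exists N. intros n Hn.
  specialize (HN n Hn). cbv beta in HN.
  set (P := fun x => Csum (fun k => c k * x ^ k)%C K) in *.
  replace (avg n (fun x => G x * F x)%C)
    with (avg n (fun x => G x * (F x - P x))%C + avg n (fun x => G x * P x)%C)%C.
  2:{ rewrite <- avg_plus. apply avg_ext. intros x _. ring. }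
  assert (H1 : Cmod (avg n (fun x => G x * (F x - P x))%C) <= B * (A * rho ^ K)).
  { apply avg_Cmod_le. intros x Hx. rewrite Cmod_mult.
    apply Rmult_le_compat; try apply Cmod_ge_0; [now apply HG | now apply Htail]. }
  assert (H2 : B * (A * rho ^ K) < eps / 3).
  { assert (0 <= rho ^ K) by (apply pow_le; lra).
    apply Rle_lt_trans with ((B * A + 1) * rho ^ K); [nra |].
    replace (eps / 3) with ((B * A + 1) * (eps / 3 / (B * A + 1))) by (field; lra).
    apply Rmult_lt_compat_l; lra. }
  set (a1 := avg n (fun x => G x * (F x - P x))%C) in *.
  set (a2 := avg n (fun x => G x * P x)%C) in *.
  set (s := Csum (fun k => c k * m k)%C K) in *.
  replace (a1 + a2 - l)%C with (a1 + ((a2 - s) + (s - l)))%C by ring.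
  pose proof (Cmod_triangle a1 ((a2 - s) + (s - l))).
  pose proof (Cmod_triangle (a2 - s) (s - l)).
  change (Cmod (a2 - s) < eps / 3) in HN. lra.
Qed.

Lemma Cseries_ext (u v : nat -> C) (l : C) :
  (forall k, u k = v k) -> Cseries u l -> Cseries v l.
Proof. apply is_series_ext. Qed.

Lemma has_mean_coef c F j :
  expands c F -> has_mean (fun x => Cconj x ^ j * F x)%C (c j).
Proof.
  intros H.
  eapply (has_mean_mul_expands (fun x => Cconj x ^ j)%C F 1 c); [lra | | exact H | |].
  - intros x Hx. rewrite Cmod_pow, Cmod_conj, Hx, pow1. lra.
  - intros k. apply has_mean_conj_pow_pow.
  - eapply Cseries_ext; [| exact (Cseries_single j (c j))].
    intros k. cbv beta. destruct (Nat.eqb_spec k j) as [-> |]; ring.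
Qed.

Lemma has_mean_expands c F : expands c F -> has_mean F (c 0%nat).
Proof.
  intros H. eapply has_mean_ext; [| exact (has_mean_coef c F 0 H)].
  intros x _. simpl. ring.
Qed.

Lemma has_mean_conj_mul c F d H l :
  expands c F -> expands d H -> Cseries (fun k => c k * Cconj (d k))%C l ->
  has_mean (fun x => Cconj (H x) * F x)%C l.
Proof.
  intros HF HH Hl. destruct (expands_bounded d H HH) as (B & HB & Hbd).
  apply (has_mean_mul_expands (fun x => Cconj (H x)) F B c (fun k => Cconj (d k))); try assumption.
  - intros x Hx. rewrite Cmod_conj. now apply Hbd.
  - intros k. eapply has_mean_ext; [| exact (has_mean_conj _ _ (has_mean_coef d H k HH))].
    intros x _. cbv beta. rewrite Cmult_conj, <- Cpow_conj, Cconj_conj. ring.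
Qed.

(** The mean of an analytic function is its value at the centre; here the function is
    the product [F * H]. *)
Lemma has_mean_mul c F d H :
  expands c F -> expands d H -> has_mean (fun x => F x * H x)%C (c 0%nat * d 0%nat)%C.
Proof.
  intros HF HH. destruct (expands_bounded c F HF) as (B & HB & Hbd).
  apply (has_mean_mul_expands F H B d (fun k => if Nat.eqb k 0 then c 0%nat else RtoC 0));
    try assumption.
  - intros k.
    apply has_mean_ext with (fun x => x ^ k * F x)%C; [intros x _; ring |].
    apply (has_mean_mul_expands (fun x => x ^ k)%C F 1 c
             (fun i => if Nat.eqb (k + i) 0 then RtoC 1 else RtoC 0)); try assumption; try lra.
    + intros x Hx. rewrite Cmod_pow, Hx, pow1. lra.
    + intros i. eapply has_mean_ext; [| exact (has_mean_pow (k + i))].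
      intros x _. cbv beta. apply Cpow_add_r.
    + eapply Cseries_ext; [| exact (Cseries_single 0 (if Nat.eqb k 0 then c 0%nat else RtoC 0))].
      intros i. cbv beta. destruct k, i; simpl; ring.
  - eapply Cseries_ext; [| exact (Cseries_single 0 (c 0%nat * d 0%nat)%C)].
    intros k. cbv beta. destruct k; simpl; ring.
Qed.

(** For [q = Cconj p] this is the reproducing kernel at [p]: by Parseval, the mean of
    [Cconj k * F] is the value at [p] of the power series of [F]. *)
Lemma expands_geom (q : C) :
  Cmod q < 1 -> expands (fun k => q ^ k)%C (fun x => / (1 - q * x))%C.
Proof.
  intros Hq. split.
  - exists 1, (Cmod q). pose proof (Cmod_ge_0 q). repeat split; try lra.
    intros k. rewrite Cmod_pow. lra.
  - intros x Hx. eapply Cseries_ext; [| apply Cseries_geom].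
    + intros k. apply Cpow_mult_l.
    + rewrite Cmod_mult, Hx. lra.
Qed.

Lemma pow_n_Cpow (z : C) (k : nat) : pow_n (K := C_Ring) z k = (z ^ k)%C.
Proof.
  induction k as [|k IH]; [reflexivity |].
  exact (f_equal (Cmult z) IH).
Qed.

Lemma pseries_Cseries (a : nat -> C) (z l : C) :
  is_pseries (K := C_AbsRing) (V := C_NormedModule) a z l <->
  Cseries (fun k => a k * z ^ k)%C l.
Proof.
  assert (E : forall k, Cmult (pow_n (K := C_Ring) z k) (a k) = (a k * z ^ k)%C)
    by (intros k; rewrite pow_n_Cpow; apply Cmult_comm).
  split; apply is_series_ext; intros k; [apply E | symmetry; apply E].
Qed.

Lemma Cseries_terms_bounded (u : nat -> C) (l : C) :
  Cseries u l -> exists M, 0 <= M /\ forall k, Cmod (u k) <= M.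
Proof.
  intros H.
  destruct (filterlim_bounded (K := C_AbsRing) (V := C_NormedModule) (Csum u)) as [M HM].
  { now exists l. }
  change (forall n, Cmod (Csum u n) <= M) in HM.
  assert (HM0 : 0 <= M) by (eapply Rle_trans; [apply Cmod_ge_0 | apply (HM 0%nat)]).
  exists (M + M). split; [lra |]. intros [|k].
  - rewrite <- (Csum_0 u). specialize (HM 0%nat). lra.
  - replace (u (S k)) with (Csum u (S k) + - Csum u k)%C by (rewrite Csum_S; ring).
    eapply Rle_trans; [apply Cmod_triangle |]. rewrite Cmod_opp.
    pose proof (HM k). pose proof (HM (S k)). lra.
Qed.

(** The terms of the series at the larger radius [s = (1 + r) / 2] are bounded, which
    gives the ratio [r / s]. *)
Lemma expands_dilation (a : nat -> C) (f : C -> C) (r : R) :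
  0 <= r < 1 ->
  (forall z, Cmod z < 1 -> Cseries (fun k => a k * z ^ k)%C (f z)) ->
  expands (fun k => a k * r ^ k)%C (fun x => f (r * x)%C).
Proof.
  intros Hr Hf. split.
  - set (s := (1 + r) / 2).
    assert (Hs : Cmod s < 1) by (rewrite Cmod_R, Rabs_pos_eq; unfold s; lra).
    destruct (Cseries_terms_bounded _ _ (Hf _ Hs)) as (M & HM & Hb).
    exists M, (r / s). repeat split; try assumption.
    + apply Rmult_le_pos; [lra | left; apply Rinv_0_lt_compat; unfold s; lra].
    + apply Rmult_lt_reg_r with s; [unfold s; lra |].
      replace (r / s * s) with r by (field; unfold s; lra). unfold s; lra.
    + intros k. specialize (Hb k). rewrite Cmod_mult, Cmod_pow, Cmod_R in *.
      rewrite Rabs_pos_eq in * by (unfold s; lra).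
      replace (r ^ k) with (s ^ k * (r / s) ^ k)
        by (rewrite <- Rpow_mult_distr; f_equal; field; unfold s; lra).
      rewrite <- Rmult_assoc. apply Rmult_le_compat_r; [| exact Hb].
      apply pow_le, Rmult_le_pos; [lra | left; apply Rinv_0_lt_compat; unfold s; lra].
  - intros x Hx. eapply Cseries_ext; [| apply Hf].
    + intros k. cbv beta. rewrite Cpow_mult_l. ring.
    + rewrite Cmod_mult, Cmod_R, Rabs_pos_eq, Hx; lra.
Qed.

(** * The Schwarz-Pick inequality at the origin *)

(** The Cauchy-Schwarz step of the Schwarz-Pick inequality in pointwise form:
    [2 |F| |u| |q| <= |u|^2 + |q|^2] for [|F| <= 1]. *)
Lemma Re_quadratic_ge0 (F u q : C) :
  Cmod F <= 1 -> 0 <= Re (q * Cconj q + u * Cconj u - 2 * (F * u * Cconj q)).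
Proof.
  intros HF. rewrite <- !Cmod2_conj.
  pose proof (re_le_Cmod (F * u * Cconj q)) as H.
  rewrite !Cmod_mult, Cmod_conj in H.
  pose proof (Rle_abs (Re (F * u * Cconj q))).
  unfold Cminus. rewrite !re_plus, re_opp, re_scal_l, !re_RtoC.
  pose proof (Cmod_ge_0 u). pose proof (Cmod_ge_0 q). pose proof (Cmod_ge_0 F).
  assert (Cmod F * Cmod u * Cmod q <= Cmod u * Cmod q).
  { assert (0 <= Cmod u * Cmod q) by now apply Rmult_le_pos. nra. }
  pose proof (pow2_ge_0 (Cmod q - Cmod u)). nra.
Qed.

(** The Szego kernel times its conjugate is, up to a factor, the Poisson kernel, which
    is a sum of an analytic and an anti-analytic function. Products of kernels thus
    need no moments beyond those of [k] and [Cconj k]. *)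
Lemma szego_poisson (p x : C) :
  Cmod p < 1 -> Cmod x = 1 ->
  let k := (/ (1 - Cconj p * x))%C in
  (k * Cconj k = RtoC (/ (1 - Cmod p ^ 2)) * (k + Cconj k - 1))%C.
Proof.
  intros Hp Hx k.
  assert (Hd : (1 - Cconj p * x)%C <> 0).
  { intros H. assert (E : (Cconj p * x)%C = 1).
    { replace (Cconj p * x)%C with (1 - (1 - Cconj p * x))%C by ring. rewrite H. ring. }
    apply (f_equal Cmod) in E. rewrite Cmod_mult, Cmod_conj, Hx, Cmod_1 in E. lra. }
  assert (Hd' : (1 - p * Cconj x)%C <> 0).
  { intros H. apply Hd. apply (f_equal Cconj) in H.
    rewrite Cminus_conj, Cmult_conj, Cconj_conj in H.
    rewrite Cconj_RtoC in H. rewrite H. apply Cconj_RtoC. }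
  assert (Ek : Cconj k = (/ (1 - p * Cconj x))%C).
  { unfold k. rewrite Cinv_conj by exact Hd.
    now rewrite Cminus_conj, Cmult_conj, Cconj_conj, Cconj_RtoC. }
  pose proof (Cmod_ge_0 p).
  rewrite Ek. unfold k. rewrite RtoC_inv by nra. rewrite RtoC_minus, Cmod2_conj.
  assert (Hn : (1 - p * Cconj p)%C <> 0).
  { rewrite <- Cmod2_conj, <- RtoC_minus. intros H0. apply RtoC_inj in H0. nra. }
  replace (/ (1 - Cconj p * x) + / (1 - p * Cconj x) - 1)%C
    with ((1 - p * Cconj p * (Cconj x * x)) / ((1 - Cconj p * x) * (1 - p * Cconj x)))%C
    by (field; split; assumption).
  rewrite (conj_unit x Hx). field. repeat split; assumption.
Qed.

(** Multiplication by the conjugate of [F], followed by projection on the analytic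
    functions, is a contraction, and it maps the kernels [1] and [k] at the points 0 and
    [p] to [Cconj c0] and [Cconj w * k]. Hence it maps [q = al + D * k] to
    [u = ga + de * k], and the mean of [|u|^2] is at most that of [|q|^2]. This holds for all
    [al] and [D]; the coefficients below minimize the quadratic form obtained, for which
    the inequality becomes the Schwarz-Pick inequality. Instead of the projection, the
    proof takes the mean of [|q|^2 + |u|^2 - 2 F u (Cconj q)], whose real part is
    nonnegative and where the mean of the last product equals that of [|u|^2]. *)
Lemma schwarz_pick_circle (c : nat -> C) (F : C -> C) (p w : C) :
  expands c F -> (forall x, Cmod x = 1 -> Cmod (F x) <= 1) ->
  Cmod p < 1 -> Cseries (fun k => c k * p ^ k)%C w -> Cmod (c 0%nat) < 1 ->
  (1 - Cmod p ^ 2) * Cmod (w - c 0%nat) ^ 2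
  <= Cmod p ^ 2 * ((1 - Cmod (c 0%nat) ^ 2) * (1 - Cmod w ^ 2)).
Proof.
  intros HF Hbd Hp Hw Hc0.
  set (c0 := c 0%nat) in *.
  set (kf := fun x => (/ (1 - Cconj p * x))%C).
  assert (Hk : expands (fun k => Cconj p ^ k)%C kf).
  { apply expands_geom. now rewrite Cmod_conj. }
  assert (M1 : has_mean kf 1) by exact (has_mean_expands _ _ Hk).
  assert (M2 : has_mean (fun x => Cconj (kf x)) 1).
  { rewrite <- (Cconj_RtoC 1). now apply has_mean_conj. }
  assert (MF : has_mean F c0) by exact (has_mean_expands _ _ HF).
  assert (MFk : has_mean (fun x => F x * kf x)%C (c0 * 1)%C) by exact (has_mean_mul _ _ _ _ HF Hk).
  assert (MFc : has_mean (fun x => Cconj (kf x) * F x)%C w).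
  { apply (has_mean_conj_mul c F (fun k => Cconj p ^ k)%C kf); try assumption.
    eapply Cseries_ext; [| exact Hw]. intros k. cbv beta.
    now rewrite Cpow_conj, Cconj_conj. }
  set (K := / (1 - Cmod p ^ 2)).
  set (D := 1 - Cmod c0 ^ 2).
  set (al := (c0 * Cconj w - 1)%C).
  set (ga := (al * Cconj c0)%C).
  set (de := (D * Cconj w)%C).
  set (T := (K * (D * D + de * Cconj de))%C).
  (* Coefficients of the quadratic expression on 1, [k], [Cconj k], [F], [F * k] and
     [F * Cconj k], once [k * Cconj k] is replaced by the Poisson kernel. *)
  set (x0 := (al * Cconj al + ga * Cconj ga - T)%C).
  set (x1 := (Cconj al * D + Cconj ga * de + T)%C).
  set (x2 := (al * D + ga * Cconj de + T)%C).
  set (y0 := (- 2 * (ga * Cconj al - de * D * K))%C).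
  set (y1 := (- 2 * (de * Cconj al + de * D * K))%C).
  set (y2 := (- 2 * (ga * D + de * D * K))%C).
  pose proof (has_mean_plus _ _ _ _ (has_mean_const x0)
    (has_mean_plus _ _ _ _ (has_mean_scal x1 _ _ M1)
    (has_mean_plus _ _ _ _ (has_mean_scal x2 _ _ M2)
    (has_mean_plus _ _ _ _ (has_mean_scal y0 _ _ MF)
    (has_mean_plus _ _ _ _ (has_mean_scal y1 _ _ MFk) (has_mean_scal y2 _ _ MFc)))))) as M.
  apply has_mean_Re_ge0 in M.
  - assert (HD : 0 < D) by (unfold D; pose proof (Cmod_ge_0 c0); nra).
    assert (HK : 0 < 1 - Cmod p ^ 2) by (pose proof (Cmod_ge_0 p); nra).
    assert (E : D * (K * D * (1 - Cmod w ^ 2) - Cmod al ^ 2) >= 0).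
    { apply Rle_ge. eapply Rle_trans; [exact M |]. right.
      match goal with |- Re ?e = _ => replace e with
        (RtoC ((1 - Cmod c0 ^ 2 - 2 * D) * Cmod al ^ 2 + K * D ^ 2 * (1 - Cmod w ^ 2)))
      end.
      - rewrite re_RtoC. unfold D. ring.
      - repeat rewrite ?RtoC_plus, ?RtoC_minus, ?RtoC_mult, ?Cmod2_conj. rewrite RtoC_pow.
        assert (Eal : Cconj al = (Cconj c0 * w - 1)%C).
        { unfold al. now rewrite Cminus_conj, Cmult_conj, Cconj_conj, Cconj_RtoC. }
        unfold x0, x1, x2, y0, y1, y2, T, de, ga.
        rewrite !Cmult_conj, !Cconj_conj, Cconj_RtoC, Eal.
        clearbody D K. unfold al. ring. }
    assert (E2 : Cmod al ^ 2 = Cmod (w - c0) ^ 2 + D * (1 - Cmod w ^ 2)).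
    { unfold al, D. rewrite !Cmod2_alt. destruct c0 as [a b], w as [u v].
      unfold Cminus, Cplus, Cmult, Copp, Cconj, RtoC, Re, Im; simpl. ring. }
    assert (E3 : Cmod al ^ 2 <= K * D * (1 - Cmod w ^ 2)) by nra.
    rewrite E2 in E3. fold D.
    assert (E4 : (1 - Cmod p ^ 2) * (Cmod (w - c0) ^ 2 + D * (1 - Cmod w ^ 2))
                 <= D * (1 - Cmod w ^ 2)).
    { replace (D * (1 - Cmod w ^ 2)) with ((1 - Cmod p ^ 2) * (K * D * (1 - Cmod w ^ 2))) at 2
        by (unfold K; field; lra).
      apply Rmult_le_compat_l; lra. }
    lra.
  - intros x Hx.
    pose proof (szego_poisson p x Hp Hx) as HS. cbv zeta in HS. fold (kf x) K in HS.
    pose proof (Re_quadratic_ge0 (F x) (ga + de * kf x) (al + D * kf x) (Hbd x Hx)) as HR.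
    match type of HR with 0 <= Re ?e => match goal with |- 0 <= Re ?g =>
      replace g with e; [exact HR |] end end.
    rewrite !Cplus_conj, !Cmult_conj.
    rewrite Cconj_RtoC.
    unfold x0, x1, x2, y0, y1, y2, T.
    set (k := kf x) in *. set (k' := Cconj k) in *.
    set (w' := (D * D + de * Cconj de - 2 * F x * de * D)%C).
    apply Ceq_minus.
    transitivity (w' * (k * k' - K * (k + k' - 1)))%C; [unfold w'; ring |].
    rewrite HS. ring.
Qed.

(** The previous lemma applies on the circle of radius [R] with [p = z / R]; then [R]
    tends to 1. *)
Lemma schwarz_pick (a : nat -> C) (f : C -> C) (z : C) :
  (forall z, Cmod z < 1 -> Cseries (fun k => a k * z ^ k)%C (f z)) ->
  (forall z, Cmod z < 1 -> Cmod (f z) <= 1) ->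
  Cmod (a 0%nat) < 1 -> Cmod z < 1 ->
  (1 - Cmod z ^ 2) * Cmod (f z - a 0%nat) ^ 2
  <= Cmod z ^ 2 * ((1 - Cmod (a 0%nat) ^ 2) * (1 - Cmod (f z) ^ 2)).
Proof.
  intros Hf Hbd Ha Hz.
  set (X := Cmod (f z - a 0%nat) ^ 2).
  set (Y := Cmod z ^ 2 * ((1 - Cmod (a 0%nat) ^ 2) * (1 - Cmod (f z) ^ 2))).
  pose proof (Cmod_ge_0 z) as Hz0.
  assert (H : forall R, Cmod z < R < 1 -> (R ^ 2 - Cmod z ^ 2) * X <= Y).
  { intros R HR.
    assert (HRC : RtoC R <> 0) by (intros E; apply RtoC_inj in E; lra).
    assert (Ep : Cmod (z / R) = Cmod z / R)
      by (rewrite Cmod_div, Cmod_R, Rabs_pos_eq; [reflexivity | lra | exact HRC]).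
    assert (Ea : (a 0%nat * R ^ 0)%C = a 0%nat) by (simpl; ring).
    assert (Hle : Cmod z / R < 1).
    { apply Rmult_lt_reg_r with R; [lra |]. replace (Cmod z / R * R) with (Cmod z) by (field; lra).
      lra. }
    pose proof (schwarz_pick_circle (fun k => a k * R ^ k)%C (fun x => f (R * x)%C)
                  (z / R) (f z)) as P.
    cbv beta in P. rewrite Ea, Ep in P. fold X in P.
    assert (P' : (1 - (Cmod z / R) ^ 2) * X
                 <= (Cmod z / R) ^ 2 * ((1 - Cmod (a 0%nat) ^ 2) * (1 - Cmod (f z) ^ 2))).
    { apply P; try assumption.
      - apply expands_dilation; [lra | exact Hf].
      - intros x Hx. apply Hbd. rewrite Cmod_mult, Cmod_R, Rabs_pos_eq, Hx; lra.
      - eapply Cseries_ext; [| exact (Hf z Hz)]. intros k. cbv beta.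
        unfold Cdiv. rewrite Cpow_mult_l, Cpow_inv by exact HRC. field.
        now apply Cpow_nz. }
    apply (Rmult_le_compat_l (R ^ 2)) in P'; [| apply pow2_ge_0].
    replace (R ^ 2 * ((1 - (Cmod z / R) ^ 2) * X)) with ((R ^ 2 - Cmod z ^ 2) * X) in P'
      by (field; lra).
    replace (R ^ 2 * _) with Y in P' by (unfold Y; field; lra).
    exact P'. }
  destruct (Rle_lt_dec ((1 - Cmod z ^ 2) * X) Y) as [|Hlt]; [assumption | exfalso].
  assert (HX : 0 <= X) by apply pow2_ge_0.
  set (e := (1 - Cmod z ^ 2) * X - Y) in *.
  assert (He : 0 < e) by (unfold e; lra).
  (* A radius so close to 1 that it costs less than [e]. *)
  set (R := Rmax ((1 + Cmod z) / 2) (1 - e / (4 * (X + 1)))).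
  assert (Hd : 0 < e / (4 * (X + 1))) by (apply Rdiv_lt_0_compat; lra).
  assert (Hd2 : e / (4 * (X + 1)) * (X + 1) = e / 4) by (field; lra).
  assert (HR1 : (1 + Cmod z) / 2 <= R) by apply Rmax_l.
  assert (HR2 : 1 - e / (4 * (X + 1)) <= R) by apply Rmax_r.
  assert (HR3 : R < 1) by (apply Rmax_lub_lt; lra).
  specialize (H R ltac:(lra)).
  assert ((1 - R ^ 2) * X <= 2 * (1 - R) * X) by (apply Rmult_le_compat_r; nra).
  assert ((1 - R) * X <= e / (4 * (X + 1)) * X) by (apply Rmult_le_compat_r; lra).
  unfold e in *. nra.
Qed.

(** * Mean squares of the coefficients *)

Lemma has_mean_Cmod2 c F S0 :
  expands c F -> is_series (fun k => Cmod (c k) ^ 2) S0 ->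
  has_mean (fun x => Cconj (F x) * F x)%C S0.
Proof.
  intros HF HS. apply (has_mean_conj_mul c F c F); try assumption.
  eapply Cseries_ext; [| exact (Cseries_RtoC _ _ HS)].
  intros k. apply Cmod2_conj.
Qed.

Lemma coef_norm_le_1 c F S0 :
  expands c F -> is_series (fun k => Cmod (c k) ^ 2) S0 ->
  (forall x, Cmod x = 1 -> Cmod (F x) <= 1) -> S0 <= 1.
Proof.
  intros HF HS Hbd.
  pose proof (has_mean_plus _ _ _ _ (has_mean_const 1)
                (has_mean_scal (- (1)) _ _ (has_mean_Cmod2 c F S0 HF HS))) as M.
  apply has_mean_Re_ge0 in M.
  - rewrite <- RtoC_opp, re_plus, re_scal_l, !re_RtoC in M. lra.
  - intros x Hx. rewrite (Cmult_comm (Cconj (F x))), <- Cmod2_conj.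
    rewrite <- RtoC_opp, re_plus, re_scal_l, !re_RtoC.
    specialize (Hbd x Hx). pose proof (Cmod_ge_0 (F x)). nra.
Qed.

(** Taking means in the pointwise hypothesis: [F - c0] has mean 0, so it is orthogonal
    to constants, and with [S] the mean of [|F - c0|^2] the two sides become [S] and
    [r^2 ((1 - |c0|^2)^2 + |c0|^2 S)]. *)
Lemma coef_norm_schwarz_pick c F S0 r :
  expands c F -> is_series (fun k => Cmod (c k) ^ 2) S0 ->
  (forall x, Cmod x = 1 ->
     Cmod (F x - c 0%nat) ^ 2 <= r ^ 2 * Cmod (1 - Cconj (c 0%nat) * F x) ^ 2) ->
  (S0 - Cmod (c 0%nat) ^ 2) * (1 - r ^ 2 * Cmod (c 0%nat) ^ 2)
  <= r ^ 2 * (1 - Cmod (c 0%nat) ^ 2) ^ 2.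
Proof.
  intros HF HS Hbd.
  assert (MF : has_mean F (c 0%nat)) by exact (has_mean_expands _ _ HF).
  set (c0 := c 0%nat) in *. set (t := Cmod c0 ^ 2) in *.
  pose proof (has_mean_plus _ _ _ _ (has_mean_const (r ^ 2 - t)%R)
    (has_mean_plus _ _ _ _ (has_mean_scal ((1 - r ^ 2)%R * Cconj c0)%C _ _ MF)
    (has_mean_plus _ _ _ _ (has_mean_scal ((1 - r ^ 2)%R * c0)%C _ _ (has_mean_conj _ _ MF))
       (has_mean_scal (r ^ 2 * t - 1)%R _ _ (has_mean_Cmod2 c F S0 HF HS))))) as M.
  apply has_mean_Re_ge0 in M.
  - match type of M with 0 <= Re ?e => replace (Re e)
      with (r ^ 2 * (1 - t) ^ 2 - (S0 - t) * (1 - r ^ 2 * t)) in M; [lra |] end.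
    clear M. unfold t. rewrite Cmod2_alt. clearbody c0. destruct c0 as [a b].
    unfold Cplus, Cmult, Cconj, RtoC, Re, Im; simpl. ring.
  - intros x Hx. specialize (Hbd x Hx).
    match goal with |- 0 <= Re ?e => replace (Re e)
      with (r ^ 2 * Cmod (1 - Cconj c0 * F x) ^ 2 - Cmod (F x - c0) ^ 2); [lra |] end.
    unfold t. rewrite !Cmod2_alt. clearbody c0. destruct c0 as [a b], (F x) as [u v].
    unfold Cminus, Cplus, Cmult, Copp, Cconj, RtoC, Re, Im; simpl. ring.
Qed.

(** * The sharp radius bound *)

Lemma ex_series_sq (c : nat -> C) : geometric c -> ex_series (fun k => Cmod (c k) ^ 2).
Proof.
  intros (A & rho & HA & Hr & Hc).
  apply (ex_series_le (K := R_AbsRing) (V := R_CompleteNormedModule) _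
           (fun k => A ^ 2 * (rho ^ 2) ^ k)).
  - intros k. change (Rabs (Cmod (c k) ^ 2) <= A ^ 2 * (rho ^ 2) ^ k).
    rewrite Rabs_pos_eq by apply pow2_ge_0.
    rewrite <- pow_mult, Nat.mul_comm, pow_mult, <- Rpow_mult_distr.
    apply pow_incr. split; [apply Cmod_ge_0 | apply Hc].
  - apply (ex_series_scal (K := R_AbsRing) (V := R_NormedModule) (A ^ 2)), ex_series_geom.
    rewrite Rabs_pos_eq; nra.
Qed.

(** With [x = |f z|] and [d = |f z - a0|] the hypothesis implies
    [(x - a)^2 <= r^2 (1 - a x)^2]. *)
Lemma schwarz_pick_growth (a r x d : R) :
  0 <= a < 1 -> 0 <= r < 1 -> 0 <= x <= 1 -> x - a <= d ->
  (1 - r ^ 2) * d ^ 2 <= r ^ 2 * ((1 - a ^ 2) * (1 - x ^ 2)) ->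
  x * (1 + a * r) <= a + r.
Proof.
  intros Ha Hr Hx Hd H.
  assert (Hax : 0 <= 1 - a * x) by nra.
  destruct (Rle_lt_dec x a) as [Hxa | Hxa].
  { assert (0 <= r * (1 - a * x)) by (apply Rmult_le_pos; lra). nra. }
  assert (H1 : (x - a) ^ 2 <= d ^ 2) by (apply pow_incr; lra).
  assert (H2 : (1 - r ^ 2) * (x - a) ^ 2 <= r ^ 2 * ((1 - a ^ 2) * (1 - x ^ 2))).
  { eapply Rle_trans; [| exact H]. apply Rmult_le_compat_l; [nra | exact H1]. }
  assert (H3 : (x - a) ^ 2 <= (r * (1 - a * x)) ^ 2) by nra.
  assert (H4 : x - a <= r * (1 - a * x)).
  { destruct (Rle_lt_dec (x - a) (r * (1 - a * x))) as [|Hlt]; [assumption | exfalso].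
    assert (0 <= r * (1 - a * x)) by (apply Rmult_le_pos; lra). nra. }
  nra.
Qed.

(** With [y = a r], the two bounds add up to at most 1 exactly when
    [2 r^2 - 1 + y - y^2 - y^3 <= 0]. The cubic [y - y^2 - y^3] equals
    [5/27 - (y - 1/3)^2 (y + 5/3)], so its largest value is [5/27], at [y = 1/3], and
    [2 r^2 <= 22/27] suffices for every [a]. *)
Lemma bohr_arithmetic (a r x S : R) :
  0 <= a < 1 -> 0 <= r < 1 -> r ^ 2 <= 11 / 27 -> 0 <= x ->
  x * (1 + a * r) <= a + r ->
  S * (1 - r ^ 2 * a ^ 2) <= r ^ 2 * (1 - a ^ 2) ^ 2 ->
  x ^ 2 + S <= 1.
Proof.
  intros Ha Hr Hr2 Hx H1 H2.
  assert (Hy : 0 <= a * r < 1) by nra.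
  set (y := a * r) in *.
  assert (Hcubic : 2 * r ^ 2 - 1 + y - y ^ 2 - y ^ 3 <= 0).
  { pose proof (pow2_ge_0 (y - 1 / 3)).
    assert (0 <= (y - 1 / 3) ^ 2 * (y + 5 / 3)) by (apply Rmult_le_pos; lra).
    nra. }
  set (D := 1 - a ^ 2) in *.
  assert (HD : 0 < D) by (unfold D; nra).
  assert (Hkey : r ^ 2 * D * (1 + y) <= (1 - r ^ 2) * (1 - y)).
  { replace (r ^ 2 * D * (1 + y)) with (r ^ 2 * (1 + y) - y ^ 2 * (1 + y)) by (unfold D, y; ring).
    nra. }
  assert (Hx2 : x ^ 2 * (1 + y) ^ 2 <= (a + r) ^ 2).
  { rewrite <- Rpow_mult_distr. apply pow_incr. split; [apply Rmult_le_pos; lra | exact H1]. }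
  replace (1 - r ^ 2 * a ^ 2) with ((1 - y) * (1 + y)) in H2 by (unfold y; ring).
  assert (E : (1 + y) ^ 2 - (a + r) ^ 2 = D * (1 - r ^ 2)) by (unfold D, y; ring).
  assert (HS : S * ((1 - y) * (1 + y) ^ 2) <= D * ((1 - r ^ 2) * (1 - y))).
  { apply Rle_trans with (r ^ 2 * D ^ 2 * (1 + y)).
    - replace (S * _) with (S * ((1 - y) * (1 + y)) * (1 + y)) by ring.
      apply Rmult_le_compat_r; lra.
    - replace (r ^ 2 * D ^ 2 * (1 + y)) with (D * (r ^ 2 * D * (1 + y))) by ring.
      apply Rmult_le_compat_l; lra. }
  assert (HS' : S * (1 + y) ^ 2 <= D * (1 - r ^ 2)).
  { apply Rmult_le_reg_r with (1 - y); [lra |]. lra. }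
  apply Rmult_le_reg_r with ((1 + y) ^ 2); [nra |]. lra.
Qed.

(** Parseval's identity includes the constant term, which [sq_term] leaves out. *)
Lemma sq_term_series (a : nat -> C) (f : C -> C) (r : R) :
  0 <= r < 1 -> (forall z, Cmod z < 1 -> Cseries (fun k => a k * z ^ k)%C (f z)) ->
  ex_series (sq_term a r) /\
  is_series (fun k => Cmod (a k * r ^ k) ^ 2) (Cmod (a 0%nat) ^ 2 + Series (sq_term a r)).
Proof.
  intros Hr Hf.
  destruct (expands_dilation a f r Hr Hf) as [Hgeo _].
  pose proof (ex_series_sq _ Hgeo) as Hex. cbv beta in Hex.
  assert (Hshift : forall k, Cmod (a (S k) * r ^ S k) ^ 2 = sq_term a r k).
  { intros k. unfold sq_term. rewrite Cmod_mult, Cmod_pow, Cmod_R, Rabs_pos_eq by lra.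
    rewrite Rpow_mult_distr, <- (pow_mult r (S k)). f_equal. f_equal. lia. }
  split.
  - eapply ex_series_ext; [exact Hshift |].
    now apply (ex_series_incr_1 (fun k => Cmod (a k * r ^ k) ^ 2)).
  - pose proof (Series_correct _ Hex) as HS.
    rewrite (Series_incr_1 _ Hex) in HS.
    rewrite (Series_ext _ _ Hshift) in HS.
    replace (Cmod (a 0%nat * r ^ 0) ^ 2) with (Cmod (a 0%nat) ^ 2) in HS; [exact HS |].
    f_equal. f_equal. simpl. ring.
Qed.

(** The Schwarz-Pick inequality was obtained by dividing by [1 - |a0|^2]. When
    [|a0| = 1], Parseval's identity alone leaves no room for the other coefficients. *)
Lemma bohr_sq_inequality (a : nat -> C) (f : C -> C) (z : C) :
  (forall z, Cmod z < 1 -> Cseries (fun k => a k * z ^ k)%C (f z)) ->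
  (forall z, Cmod z < 1 -> Cmod (f z) <= 1) ->
  Cmod z < 1 -> Cmod z ^ 2 <= 11 / 27 ->
  Cmod (f z) ^ 2 + Series (sq_term a (Cmod z)) <= 1.
Proof.
  intros Hf Hbd Hz Hz2.
  pose proof (Cmod_ge_0 z) as Hz0.
  set (r := Cmod z) in *.
  assert (Hr : 0 <= r < 1) by lra.
  destruct (sq_term_series a f r Hr Hf) as [_ HS].
  pose proof (expands_dilation a f r Hr Hf) as HF.
  assert (Hmod : forall x, Cmod x = 1 -> Cmod (r * x) = r).
  { intros x Hx. rewrite Cmod_mult, Cmod_R, Rabs_pos_eq, Hx; lra. }
  assert (HF1 : forall x, Cmod x = 1 -> Cmod (f (r * x)%C) <= 1).
  { intros x Hx. apply Hbd. rewrite Hmod; lra. }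
  pose proof (coef_norm_le_1 _ _ _ HF HS HF1) as Hle.
  pose proof (Hbd z Hz) as Hfz. pose proof (Cmod_ge_0 (f z)) as Hfz0.
  pose proof (Cmod_ge_0 (a 0%nat)) as Ha0.
  assert (Ha1 : Cmod (a 0%nat) <= 1).
  { assert (E : f 0 = a 0%nat).
    { assert (H0 : Cseries (fun k => a k * 0 ^ k)%C (a 0%nat)).
      { eapply Cseries_ext; [| exact (Cseries_single 0 (a 0%nat))].
        intros [|k]; simpl; ring. }
      refine (filterlim_locally_unique (K := C_AbsRing) (V := C_NormedModule) _ _ _ (Hf 0 _) H0).
      rewrite Cmod_0. lra. }
    rewrite <- E. apply Hbd. rewrite Cmod_0. lra. }
  destruct (Req_dec (Cmod (a 0%nat)) 1) as [Ea | Ea].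
  - rewrite Ea in Hle. nra.
  - assert (Ha : Cmod (a 0%nat) < 1) by lra.
    apply (bohr_arithmetic (Cmod (a 0%nat)) r); try lra.
    + apply (schwarz_pick_growth _ _ _ (Cmod (f z - a 0%nat))); try lra.
      * pose proof (Cmod_triangle (f z - a 0%nat) (a 0%nat)) as Ht.
        replace (f z - a 0%nat + a 0%nat)%C with (f z) in Ht by ring. lra.
      * now apply schwarz_pick.
    + pose proof (coef_norm_schwarz_pick _ _ _ r HF HS) as HC. cbv beta in HC.
      replace (a 0%nat * r ^ 0)%C with (a 0%nat) in HC by (simpl; ring).
      set (t := Cmod (a 0%nat)) in *.
      replace (t ^ 2 + Series (sq_term a r) - t ^ 2) with (Series (sq_term a r)) in HC by ring.
      apply HC. intros x Hx.
      assert (Hrx : Cmod (r * x) < 1) by (rewrite Hmod; lra).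
      pose proof (schwarz_pick a f (r * x)%C Hf Hbd Ha Hrx) as HP.
      rewrite Hmod in HP by exact Hx.
      set (w := f (r * x)%C) in *.
      assert (E : Cmod (1 - Cconj (a 0%nat) * w) ^ 2
                  = Cmod (w - a 0%nat) ^ 2 + (1 - Cmod (a 0%nat) ^ 2) * (1 - Cmod w ^ 2)).
      { rewrite !Cmod2_alt. destruct (a 0%nat) as [u v], w as [c d].
        unfold Cminus, Cplus, Cmult, Copp, Cconj, RtoC, Re, Im; simpl. ring. }
      rewrite E. lra.
Qed.

(** * Extremal functions *)

Definition mobius (a : R) (z : C) : C := ((a + z) / (1 + a * z))%C.

Definition mobius_coef (a : R) (n : nat) : C :=
  match n with
  | O => RtoC a
  | S k => ((1 - a ^ 2)%R * (- a) ^ k)%C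
  end.

Lemma mobius_denominator (a : R) (z : C) :
  0 <= a < 1 -> Cmod z < 1 -> 1 - a <= Cmod (1 + a * z).
Proof.
  intros Ha Hz.
  pose proof (Cmod_triangle (1 + a * z) (- (a * z))) as H.
  replace (1 + a * z + - (a * z))%C with (RtoC 1) in H by ring.
  rewrite Cmod_1, Cmod_opp, Cmod_mult, Cmod_R, Rabs_pos_eq in H by lra.
  assert (a * Cmod z <= a) by (pose proof (Cmod_ge_0 z); nra). lra.
Qed.

Lemma mobius_denominator_neq0 (a : R) (z : C) :
  0 <= a < 1 -> Cmod z < 1 -> (1 + a * z)%C <> 0.
Proof.
  intros Ha Hz H. pose proof (mobius_denominator a z Ha Hz) as H1.
  rewrite H, Cmod_0 in H1. lra.
Qed.

Lemma mobius_series (a : R) (z : C) :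
  0 <= a < 1 -> Cmod z < 1 -> Cseries (fun k => mobius_coef a k * z ^ k)%C (mobius a z).
Proof.
  intros Ha Hz.
  pose proof (mobius_denominator_neq0 a z Ha Hz) as Hd.
  apply is_series_decr_1.
  assert (Hg : Cmod (- a * z) < 1).
  { rewrite Cmod_mult, Cmod_opp, Cmod_R, Rabs_pos_eq by lra.
    pose proof (Cmod_ge_0 z). nra. }
  apply Cseries_geom in Hg.
  apply (is_series_scal (K := C_AbsRing) (V := C_NormedModule) ((1 - a ^ 2)%R * z)%C) in Hg.
  match type of Hg with is_series _ ?l => match goal with |- is_series _ ?m =>
    replace m with l end end.
  - eapply Cseries_ext; [| exact Hg]. intros k.
    change (((1 - a ^ 2)%R * z * (- a * z) ^ k)%C = (mobius_coef a (S k) * z ^ S k)%C).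
    unfold mobius_coef. rewrite Cpow_mult_l, Cpow_S. ring.
  - change (((1 - a ^ 2)%R * z * / (1 - - a * z))%C
            = (mobius a z + - (mobius_coef a 0 * z ^ 0))%C).
    unfold mobius, mobius_coef. rewrite RtoC_minus, RtoC_pow. simpl Cpow.
    replace (1 - - a * z)%C with (1 + a * z)%C by ring. field. exact Hd.
Qed.

Lemma mobius_bounded (a : R) (z : C) :
  0 <= a < 1 -> Cmod z < 1 -> Cmod (mobius a z) <= 1.
Proof.
  intros Ha Hz.
  pose proof (mobius_denominator a z Ha Hz) as Hd.
  unfold mobius. rewrite Cmod_div by now apply mobius_denominator_neq0.
  apply Rmult_le_reg_r with (Cmod (1 + a * z)); [lra |].
  unfold Rdiv. rewrite Rmult_assoc, Rinv_l, Rmult_1_r, Rmult_1_l by lra.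
  assert (H : Cmod (1 + a * z) ^ 2 - Cmod (a + z) ^ 2 = (1 - a ^ 2) * (1 - Cmod z ^ 2)).
  { rewrite !Cmod2_alt. destruct z as [u v].
    unfold Cplus, Cmult, RtoC, Re, Im; simpl. ring. }
  pose proof (Cmod_ge_0 z). pose proof (Cmod_ge_0 (a + z)).
  assert (0 <= (1 - a ^ 2) * (1 - Cmod z ^ 2)) by (apply Rmult_le_pos; nra).
  destruct (Rle_lt_dec (Cmod (a + z)) (Cmod (1 + a * z))) as [|Hlt]; [assumption | exfalso].
  nra.
Qed.

(** The remainder of the first-order expansion at [z] is
    [- (1 - a^2) a (y - z)^2 / ((1 + a y) (1 + a z)^2)], and both denominators are at least
    [1 - a] in modulus. *)
Lemma mobius_derive (a : R) (z : C) :
  0 <= a < 1 -> Cmod z < 1 ->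
  ex_derive (K := C_AbsRing) (V := C_NormedModule) (mobius a) z.
Proof.
  intros Ha Hz.
  pose proof (mobius_denominator_neq0 a z Ha Hz) as Hd.
  exists ((1 - a ^ 2)%R / ((1 + a * z) * (1 + a * z)))%C.
  split; [apply is_linear_scal_l |].
  intros x Hx.
  apply (is_filter_lim_locally_unique (K := C_AbsRing) (V := AbsRing_NormedModule C_AbsRing)) in Hx.
  subst x. intros eps.
  set (M := (1 - a ^ 2) * a / (1 - a) ^ 3).
  assert (HM : 0 <= M).
  { apply Rmult_le_pos; [apply Rmult_le_pos; nra |].
    left. apply Rinv_0_lt_compat, pow_lt. lra. }
  assert (Hdel : 0 < Rmin (1 - Cmod z) (eps / (M + 1))).
  { apply Rmin_glb_lt; [lra |]. apply Rdiv_lt_0_compat; [apply cond_pos | lra]. }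
  exists (mkposreal _ Hdel). intros y Hy. change C in (type of y).
  change (Cmod (y - z) < Rmin (1 - Cmod z) (eps / (M + 1))) in Hy.
  change (Cmod (mobius a y - mobius a z
                - (y - z) * ((1 - a ^ 2)%R / ((1 + a * z) * (1 + a * z))))
          <= eps * Cmod (y - z)).
  pose proof (Rmin_l (1 - Cmod z) (eps / (M + 1))).
  pose proof (Rmin_r (1 - Cmod z) (eps / (M + 1))).
  assert (Hyd : Cmod y < 1).
  { pose proof (Cmod_triangle (y - z) z) as Ht.
    replace (y - z + z)%C with y in Ht by ring. lra. }
  pose proof (mobius_denominator_neq0 a y Ha Hyd) as Hdy.
  pose proof (mobius_denominator a y Ha Hyd) as H1.
  pose proof (mobius_denominator a z Ha Hz) as H2.
  replace (mobius a y - mobius a z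
           - (y - z) * ((1 - a ^ 2)%R / ((1 + a * z) * (1 + a * z))))%C
    with ((1 - a ^ 2)%R * (- a)%R * ((y - z) * (y - z))
          * / ((1 + a * y) * ((1 + a * z) * (1 + a * z))))%C
    by (unfold mobius; rewrite RtoC_minus, RtoC_pow, RtoC_opp; field; split; assumption).
  rewrite !Cmod_mult, Cmod_inv, !Cmod_mult, !Cmod_R
    by (repeat apply Cmult_neq_0; assumption).
  rewrite Rabs_Ropp, !Rabs_pos_eq by nra.
  set (h := Cmod (y - z)) in *. assert (Hh : 0 <= h) by apply Cmod_ge_0.
  set (d1 := Cmod (1 + a * y)) in *. set (d2 := Cmod (1 + a * z)) in *.
  assert (Hinv : / (d1 * (d2 * d2)) <= / (1 - a) ^ 3).
  { apply Rinv_le_contravar; [apply pow_lt; lra |].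
    replace ((1 - a) ^ 3) with ((1 - a) * ((1 - a) * (1 - a))) by ring.
    apply Rmult_le_compat; [lra | nra | exact H1 |]. apply Rmult_le_compat; lra. }
  apply Rle_trans with (M * (h * h)).
  - replace (M * (h * h)) with ((1 - a ^ 2) * a * (h * h) * / (1 - a) ^ 3)
      by (unfold M, Rdiv; ring).
    apply Rmult_le_compat_l; [| exact Hinv]. repeat apply Rmult_le_pos; nra.
  - rewrite <- Rmult_assoc. apply Rmult_le_compat_r; [exact Hh |].
    apply Rle_trans with ((M + 1) * (eps / (M + 1))); [nra |].
    right. field. lra.
Qed.

Lemma bounded_analytic_mobius (a : R) :
  0 <= a < 1 -> bounded_analytic (mobius_coef a) (mobius a).
Proof.
  intros Ha. repeat split.
  - intros z Hz. now apply mobius_derive.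
  - intros z Hz. apply pseries_Cseries. now apply mobius_series.
  - intros z Hz. now apply mobius_bounded.
Qed.

Lemma mobius_sq_term (a r : R) :
  0 <= a < 1 -> 0 <= r < 1 ->
  is_series (sq_term (mobius_coef a) r) ((1 - a ^ 2) ^ 2 * r ^ 2 / (1 - a ^ 2 * r ^ 2)).
Proof.
  intros Ha Hr.
  assert (Hq : Rabs (a ^ 2 * r ^ 2) < 1).
  { rewrite Rabs_pos_eq; [| apply Rmult_le_pos; apply pow2_ge_0].
    rewrite <- Rpow_mult_distr. assert (0 <= a * r < 1) by nra. nra. }
  pose proof (is_series_scal ((1 - a ^ 2) ^ 2 * r ^ 2) _ _ (is_series_geom _ Hq)) as H.
  eapply is_series_ext; [| exact H].
  intros k. change ((1 - a ^ 2) ^ 2 * r ^ 2 * (a ^ 2 * r ^ 2) ^ k = sq_term (mobius_coef a) r k).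
  unfold sq_term, mobius_coef.
  rewrite Cmod_mult, Cmod_pow, Cmod_opp, !Cmod_R, (Rabs_pos_eq a) by lra.
  rewrite Rabs_pos_eq by nra.
  rewrite (pow_mult r), !Rpow_mult_distr, <- !pow_mult. simpl (_ ^ S k).
  rewrite (Nat.mul_comm k 2), !pow_mult. simpl. ring.
Qed.

(** The parameter [a = 1 / (3 r)] puts [y = a r] at the maximum [1/3] of the cubic in
    the upper bound, where the excess over 1 factors and changes sign at
    [r^2 = 11/27]. *)
Lemma mobius_exceeds_1 (r : R) :
  0 < r < 1 -> 11 / 27 < r ^ 2 ->
  1 < ((/ (3 * r) + r) / (1 + / (3 * r) * r)) ^ 2
      + (1 - (/ (3 * r)) ^ 2) ^ 2 * r ^ 2 / (1 - (/ (3 * r)) ^ 2 * r ^ 2).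
Proof.
  intros Hr Hr2.
  replace (_ + _ / (1 - _)) with (1 + (27 * r ^ 2 - 11) * (9 * r ^ 2 - 1) / (144 * r ^ 2))
    by (field; lra).
  assert (0 < (27 * r ^ 2 - 11) * (9 * r ^ 2 - 1) / (144 * r ^ 2)); [| lra].
  apply Rdiv_lt_0_compat; [apply Rmult_lt_0_compat |]; lra.
Qed.

Theorem theorem6 :
  (forall (a : nat -> C) (f : C -> C), bounded_analytic a f ->
     forall z : C, Cmod z < 1 -> Cmod z <= sqrt (11 / 27) ->
       ex_series (sq_term a (Cmod z)) /\
       Cmod (f z) ^ 2 + Series (sq_term a (Cmod z)) <= 1) /\
  (forall rho : R, sqrt (11 / 27) < rho ->
     exists (a : nat -> C) (f : C -> C) (z : C),
       bounded_analytic a f /\ Cmod z < 1 /\ Cmod z <= rho /\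
       ex_series (sq_term a (Cmod z)) /\
       1 < Cmod (f z) ^ 2 + Series (sq_term a (Cmod z))).
Proof.
  assert (Hs2 : sqrt (11 / 27) ^ 2 = 11 / 27) by (apply pow2_sqrt; lra).
  assert (Hs0 : 0 < sqrt (11 / 27)) by (apply sqrt_lt_R0; lra).
  split.
  - intros a f (_ & Hser & Hbd) z Hz Hzr.
    assert (Hf : forall z, Cmod z < 1 -> Cseries (fun k => a k * z ^ k)%C (f z))
      by (intros x Hx; now apply pseries_Cseries, Hser).
    pose proof (Cmod_ge_0 z). split.
    + apply (sq_term_series a f); [lra | exact Hf].
    + apply bohr_sq_inequality; try assumption.
      rewrite <- Hs2. apply pow_incr. lra.
  - intros rho Hrho.
    assert (Hs1 : sqrt (11 / 27) < 1) by nra.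
    (* Any radius above the critical one and below both [rho] and 1 will do. *)
    set (r := Rmin rho ((1 + sqrt (11 / 27)) / 2)).
    assert (Hr1 : r <= rho) by apply Rmin_l.
    assert (Hr2 : r <= (1 + sqrt (11 / 27)) / 2) by apply Rmin_r.
    assert (Hr3 : sqrt (11 / 27) < r) by (apply Rmin_glb_lt; lra).
    assert (Hr4 : 11 / 27 < r ^ 2) by nra.
    set (a := / (3 * r)).
    assert (Ha3 : a * (3 * r) = 1) by (unfold a; field; lra).
    assert (Ha : 0 <= a < 1).
    { assert (0 < a) by (apply Rinv_0_lt_compat; lra). split; [lra |]. nra. }
    assert (Hcr : Cmod r = r) by (rewrite Cmod_R; apply Rabs_pos_eq; lra).
    pose proof (mobius_sq_term a r Ha ltac:(lra)) as HS.
    exists (mobius_coef a), (mobius a), (RtoC r). rewrite Hcr.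
    repeat split; try lra.
    + now apply bounded_analytic_mobius.
    + now apply bounded_analytic_mobius.
    + now apply bounded_analytic_mobius.
    + eexists. exact HS.
    + rewrite (is_series_unique _ _ HS).
      unfold mobius.
      rewrite <- RtoC_mult, <- !RtoC_plus, <- RtoC_div by nra.
      rewrite Cmod_R, RPow_abs, Rabs_pos_eq by apply pow2_ge_0.
      apply mobius_exceeds_1; lra.
Qed.
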